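(* Let $T$ be a Magnus marking of a group $H$ such that $t:=|T|-1\ge 2$. Then for every finite subset $A\subset H$, $$|A(T\cup T^{-1})\setminus A|\ge 2\left(t-\frac1t\right)|A|+\frac{2(t+1)}{t}.$$
   Context: A finite generating set $T$ of a group $H$ is called a Magnus marking if every proper subset $T'\subsetneq T$ freely generates a free subgroup of $H$ (i.e. $T'$ is a free basis of the subgroup $\langle T'\rangle$). For subsets $A,B\subset H$, $AB=\{ab: a\in A,\ b\in B\}$ and $B^{-1}=\{b^{-1}:b\in B\}$; $|A|$ denotes the cardinality of $A$.
   Formalization: The finite subset A is assumed nonempty: for A empty the printed inequality would read 0 ≥ 2(t+1)/t, which is false (for example, for T a free basis of a free group of rank 3). *)

(* Defs.v *)
From HB Require Import structures.
From mathcomp Require Export all_boot all_order all_algebra.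
From mathcomp Require Export finmap.

Set Implicit Arguments.
Unset Strict Implicit.
Unset Printing Implicit Defensive.

Local Open Scope group_scope.
Local Open Scope fset_scope.

Definition gen_subgroup (H : groupType) (S : {fset H}) (x : H) : Prop :=
  forall K : H -> Prop,
    K 1 ->
    (forall y z, K y -> K z -> K (y * z)) ->
    (forall y, K y -> K y^-1) ->
    (forall s, s \in S -> K s) ->
    K x.

Definition generates (H : groupType) (S : {fset H}) : Prop :=
  forall x : H, gen_subgroup S x.

(* The letter (s, false) stands for s, and (s, true) for its formal inverse.  *)
Definition letter_val (H : groupType) (l : H * bool) : H :=
  if l.2 then l.1^-1 else l.1.

Definition word_val (H : groupType) (w : seq (H * bool)) : H :=
  \prod_(l <- w) letter_val l.

Definition word_over (H : groupType) (S : {fset H}) (w : seq (H * bool)) :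
  bool := all (fun l => l.1 \in S) w.

(* No letter is followed by its formal inverse; this is syntactic, so s and a *)
(* different symbol s' that happens to equal s^-1 in H do not cancel.         *)
Definition reduced (H : groupType) (w : seq (H * bool)) : bool :=
  sorted (fun l m => ~~ ((l.1 == m.1) && (l.2 != m.2))) w.

(* S is a free basis of the subgroup it generates: with the free group on S   *)
(* realised as the reduced words over S, the map from it to <S> induced by    *)
(* the inclusion of S is a bijection.                                         *)
Definition freely_generates (H : groupType) (S : {fset H}) : Prop :=
  forall x : H, gen_subgroup S x ->
    exists! w : seq (H * bool), [/\ word_over S w, reduced w & word_val w = x].

Definition magnus_marking (H : groupType) (T : {fset H}) : Prop :=
  generates T /\ forall T' : {fset H}, T' `<` T -> freely_generates T'.

Definition fset_mul (H : groupType) (A B : {fset H}) : {fset H} :=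
  [fset a * b | a in A, b in B].

Definition fset_inv (H : groupType) (B : {fset H}) : {fset H} :=
  [fset b^-1 | b in B].

(* Main.v *)
Require Import Defs.
From mathcomp Require Import zify ring lra.
Import GRing.Theory Num.Theory.

(* Let m = t + 1 = |T|, and let B be the boundary A(T u T^-1) \ A.  For every *)
(* s in T, the Cayley graph of H with respect to T \ s is a forest; applied   *)
(* to the union of A and the part of B adjacent to A without using s, this    *)
(* gives e_s + sum_(b in B) (d_s(b) - 1)^+ <= |A| - 1, where e_s counts the   *)
(* edges inside A and d_s(b) the edges from b to A, both with labels other    *)
(* than s.  With e and d(b) the same counts for all labels, sum over s: each  *)
(* edge inside A is counted t times, and                                      *)
(* sum_s (d_s(b) - 1)^+ >= m (d(b) - 1) - d(b) = t (d(b) - 1) - 1, which is   *)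
(* at least t (d(b) - 1) / 2 if d(b) >= 2 because t >= 2.  The conclusion     *)
(* follows from the degree count 2 e + sum_b d(b) = 2 m |A|.                  *)

Section Forest.
Local Set Implicit Arguments.
Local Unset Strict Implicit.
Local Open Scope fset_scope.
Local Open Scope nat_scope.
Variable H : groupType.
Implicit Types (S V A B : {fset H}) (x s : H) (w : seq (H * bool)).

Lemma sum_eqb_mem A (c : H) : \sum_(a <- A) (a == c) = (c \in A).
Proof.
rewrite -(count_uniq_mem c (fset_uniq A)) -sum1_count [RHS]big_mkcond /=.
by apply: eq_bigr => i _; case: (i == c).
Qed.

Lemma sum_mulg_mem A B (g : H) :
  \sum_(a <- A) ((a * g)%g \in B) = \sum_(b <- B) ((b * g^-1)%g \in A).
Proof.
under eq_bigr => a _ do rewrite -sum_eqb_mem.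
rewrite exchange_big /=; apply: eq_bigr => b _; rewrite -sum_eqb_mem.
by apply: eq_bigr => a _; congr nat_of_bool; apply/eqP/eqP => ->;
  rewrite ?mulgK ?mulgVK.
Qed.

(** * Finite subgraphs of the Cayley graph of a free basis are forests *)

Definition reduced_free S : Prop :=
  forall w, word_over S w -> reduced w -> word_val w = 1%g -> w = [::].

Lemma freely_generates_reduced_free S : freely_generates S -> reduced_free S.
Proof.
move=> freeS w Sw rw w1.
have [|w0 [_ uw0]] := freeS 1%g; first by move=> K K1 *.
rewrite -(uw0 w) //; apply: uw0; split=> //.
by rewrite /word_val big_nil.
Qed.

(** Edges from [x] into [V] are counted by signed label; [x] itself may lie outside [V]. *)
Definition deg S V x : nat :=
  \sum_(s <- S) (((x * s)%g \in V) + ((x * s^-1)%g \in V)).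

Definition edges S V : nat := \sum_(s <- S) \sum_(x <- V) ((x * s)%g \in V).

(** Only one signed letter is the formal inverse of [l0], so of two letters that lead from [x] into
    [V] at least one does not backtrack. *)
Lemma deg_gt1_extend S V x (l0 : H * bool) : 1 < deg S V x ->
  exists l : H * bool, [/\ l.1 \in S, ~~ ((l0.1 == l.1) && (l0.2 != l.2))
    & (x * letter_val l)%g \in V].
Proof.
pose L := [seq (s, b) | s <- S, b <- [:: false; true]].
have uL : uniq L by apply: allpairs_uniq; rewrite ?fset_uniq // => -[? ?] [? ?].
pose P (l : H * bool) := (x * letter_val l)%g \in V.
have -> : deg S V x = count P L.
  rewrite -sum1_count big_mkcond /= big_allpairs_dep /=.
  apply: eq_bigr => s _; rewrite !big_cons big_nil addn0 /P /letter_val /=.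
  by do 2!case: (_ \in _).
move=> gt1; pose f := (l0.1, ~~ l0.2).
have /hasP[l lL /andP[Pl nl]] : has [predI P & predC1 f] L.
  rewrite has_count -(ltn_add2l 1) addn0; apply: leq_trans gt1 _.
  rewrite -size_filter -(count_predC (pred1 f)) !count_filter.
  apply: leq_add; last by apply: sub_count => l /=; rewrite andbC.
  apply: (@leq_trans (count_mem f L)); first by apply: sub_count => l /andP[].
  by rewrite (count_uniq_mem f uL) leq_b1.
have /allpairsP[[s b] /= [sS _ El]] := lL; exists l; split=> //.
  by rewrite El.
move: nl; rewrite El inE xpair_eqE; apply: contra => /= /andP[/eqP -> nb].
by rewrite eqxx; case: b l0.2 nb {El} => [] [].
Qed.

(** The letter [l0], thought of as read just before [x], lets the induction carry the
    non-backtracking condition across the first step; an arbitrary one serves to start a walk. *)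
Lemma deg_gt1_walk S V : (forall x, x \in V -> 1 < deg S V x) ->
  forall n x (l0 : H * bool), x \in V ->
  exists w, [/\ size w = n, word_over S w,
    path (fun l m => ~~ ((l.1 == m.1) && (l.2 != m.2))) l0 w
    & forall i, (x * word_val (take i w))%g \in V].
Proof.
move=> degV; elim=> [|n IHn] x l0 xV.
  by exists [::]; split=> // i; rewrite /word_val big_nil mulg1.
have [l [lS l0l xlV]] := deg_gt1_extend l0 (degV _ xV).
have [w [<- Sw lw wV]] := IHn _ l xlV.
exists (l :: w); split=> //=; first exact/andP.
  exact/andP.
case=> [|i]; rewrite /word_val /= ?big_nil ?mulg1 // big_cons mulgA.
exact: wV.
Qed.

(* Otherwise a reduced walk of length |V| stays in V, so it visits some vertex *)
(* twice, and the word read in between is a nontrivial relation.              *)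
Lemma exists_leaf S V : reduced_free S -> V != fset0 ->
  exists2 x, x \in V & deg S V x <= 1.
Proof.
move=> freeS /fset0Pn[x xV].
suff /hasP[y yV dy] : has (fun y => deg S V y <= 1) V by exists y.
apply/negPn/negP=> /hasPn degV.
have {}degV y : y \in V -> 1 < deg S V y by move=> /degV; rewrite -ltnNge.
have [w [sw Sw rw wV]] := deg_gt1_walk degV #|` V| (1%g, false) xV.
pose p := [seq (x * word_val (take i w))%g | i <- iota 0 (size w).+1].
have : ~~ uniq p.
  apply/negP=> up; have := uniq_leq_size up (s2 := V).
  rewrite size_map size_iota sw ltnn => Hp; apply: notF; apply: Hp.
  by move=> _ /mapP[i _ ->].
move=> /(uniqPn x)[i [j [ij]]]; rewrite size_map size_iota => jw.
rewrite !(nth_map 0) ?size_iota // ?(ltn_trans ij) // !nth_iota ?(ltn_trans ij) //.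
rewrite !add0n => /mulgI Eij.
have Ew : take j w = take i w ++ drop i (take j w).
  by rewrite -{1}(cat_take_drop i (take j w)) take_takel // ltnW.
suff /(congr1 size) : drop i (take j w) = [::].
  by rewrite size_drop size_takel //= => /eqP; rewrite subn_eq0 leqNgt ij.
apply: freeS.
- have /allP Sw' := Sw; apply/allP=> l /mem_drop /mem_take; exact: Sw'.
- exact/drop_sorted/take_sorted/(path_sorted rw).
- by move: Eij; rewrite {1}Ew /word_val big_cat /= -[LHS]mulg1 => /mulgI <-.
Qed.

(** Induction by removing a leaf, which costs one vertex and at most one edge. *)
Lemma edges_forest S V : reduced_free S -> V != fset0 -> edges S V < #|` V|.
Proof.
move=> freeS; elim/finSet_rect: V => V IHV V0.
have [x xV dx] := exists_leaf freeS V0.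
have [W0|W0] := eqVneq (V `\ x) fset0.
  have V1 : V = [fset x] by rewrite -(fsetD1K xV) W0 fsetU0.
  rewrite V1 cardfs1 ltnS leqn0 /edges big_seq big1 // => s sS.
  (* An edge on a single vertex is a loop, so its label is a reduced word of length one with value
     1. *)
  rewrite big_seq_fset1 inE; apply/eqP; rewrite eqb0; apply/eqP=> xs.
  have /freeS : word_over S [:: (s, false)] by rewrite /word_over /= sS.
  move=> /(_ isT); rewrite /word_val big_seq1 /letter_val /= => Hs.
  by have /Hs : s = 1%g by apply: (mulgI x); rewrite mulg1.
have ltW := fproperD1 xV.
have := IHV _ ltW W0; rewrite [in X in _ -> X](cardfsD1 x V) xV.
suff : edges S V <= edges S (V `\ x) + deg S V x by lia.
rewrite /edges /deg -big_split /=; apply: leq_sum => s _.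
rewrite (big_fsetD1 x) //= addnCA leq_add2l.
apply: (@leq_trans (\sum_(y <- V `\ x)
   (((y * s)%g \in V `\ x) + ((y * s)%g \in [fset x])))).
  apply: leq_sum => y _; rewrite !inE.
  by case: eqVneq => [->|] /=; case: (_ \in V).
rewrite big_split /= leq_add2l sum_mulg_mem big_seq_fset1 !inE.
by case: (_ == x); case: (_ \in V).
Qed.

(** * Counting edges between a set and its boundary *)

Lemma sum_fsetU_disjoint A B (F : H -> nat) : [disjoint A & B]%fset ->
  \sum_(x <- A `|` B) F x = \sum_(x <- A) F x + \sum_(x <- B) F x.
Proof.
move=> /fdisjointP dAB; rewrite -big_cat; apply: perm_big.
apply: uniq_perm => [||x]; rewrite ?fset_uniq ?mem_cat ?inE //.
by rewrite cat_uniq !fset_uniq andbT; apply/hasPn=> x xB; apply: contraL xB => /dAB.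
Qed.

Lemma mem_fsetU_disjoint A B x : [disjoint A & B]%fset ->
  (x \in A `|` B) = (x \in A) + (x \in B) :> nat.
Proof.
move=> /fdisjointP/(_ x); rewrite inE.
by case: (x \in A) (x \in B) => [] [] // /(_ isT).
Qed.

Lemma edges_forest_boundary S A B : reduced_free S -> A != fset0 ->
  [disjoint A & B]%fset ->
  edges S A + \sum_(b <- B) (deg S A b - 1) < #|` A|.
Proof.
(* A point of [B] with no edge to [A] would add a vertex but no edge, whereas its truncated term
   [deg S A b - 1] is 0; hence it is left out of the forest. *)
move=> freeS A0 dAB; pose B' := [fset b in B | 0 < deg S A b].
have dAB' : [disjoint A & B']%fset.
  by apply/fdisjointP=> a /(fdisjointP dAB) aB; rewrite !inE (negPf aB).
have AB0 : A `|` B' != fset0 by rewrite fsetU_eq0 negb_and A0.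
have := edges_forest freeS AB0.
rewrite cardfsU (disjoint_fsetI0 dAB') cardfs0 subn0.
have : edges S A + \sum_(b <- B') deg S A b <= edges S (A `|` B').
  rewrite /edges /deg [X in _ + X]exchange_big -big_split /=; apply: leq_sum => s _.
  rewrite sum_fsetU_disjoint // big_split /= addnCA addnC leq_add //.
    rewrite -sum_mulg_mem -big_split /=.
    by apply: leq_sum => x _; rewrite mem_fsetU_disjoint.
  by apply: leq_sum => x _; rewrite mem_fsetU_disjoint // leq_addr.
have : \sum_(b <- B) (deg S A b - 1) + #|` B'| = \sum_(b <- B') deg S A b.
  rewrite card_fset_sum1 !big_fset /= !(big_mkcond (fun b => 0 < _)) -big_split /=.
  by apply: eq_bigr => b _; case: (deg S A b) => //= d; rewrite subn1 addn1.
by lia.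
Qed.

(** Every point of [A] emits two signed edges per label; those inside [A] are seen from both ends,
    the others end in [B]. In the proof [e1] counts the edges out along [s], and [e2] those along
    its inverse. *)
Lemma sum_deg_boundary S A B : [disjoint A & B]%fset ->
  (forall a s, a \in A -> s \in S ->
     ((a * s)%g \in A `|` B) && ((a * s^-1)%g \in A `|` B)) ->
  2 * edges S A + \sum_(b <- B) deg S A b = 2 * (#|` S| * #|` A|).
Proof.
move=> dAB bdry; rewrite /edges /deg [X in _ + X]exchange_big big_distrr -big_split /=.
rewrite [#|` S|]card_fset_sum1 big_distrl big_distrr /=.
apply: eq_big_seq => s sS; rewrite big_split /= mul1n.
have e1 : #|` A| = \sum_(a <- A) ((a * s)%g \in A) +
    \sum_(b <- B) ((b * s^-1)%g \in A).
  rewrite -sum_mulg_mem -big_split card_fset_sum1; apply: eq_big_seq => a aA /=.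
  by rewrite -mem_fsetU_disjoint //; case/andP: (bdry a s aA sS) => ->.
have e2 : #|` A| = \sum_(a <- A) ((a * s)%g \in A) +
    \sum_(b <- B) ((b * s)%g \in A).
  have := sum_mulg_mem A B s^-1%g; rewrite invgK => <-.
  rewrite sum_mulg_mem -big_split card_fset_sum1.
  apply: eq_big_seq => a aA /=.
  by rewrite -mem_fsetU_disjoint //; case/andP: (bdry a s aA sS) => _ ->.
by rewrite !mul2n -!addnn {1}e1 e2 addnACA addnC.
Qed.

Lemma deg_fsetD1_sum S A b : 2 < #|` S| ->
  (#|` S| - 1) * (deg S A b - 1) <= 2 * \sum_(s <- S) (deg (S `\ s) A b - 1).
Proof.
move=> S3; have [d1|d2] := leqP (deg S A b) 1.
  by rewrite (_ : deg S A b - 1 = 0) ?muln0 //; lia.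
(* Deleting [s] loses exactly the edges at [b] labelled [s], and these losses add up to
   [deg S A b]. *)
have : #|` S| * deg S A b <=
    \sum_(s <- S) (deg (S `\ s) A b - 1) + #|` S| + deg S A b.
  rewrite {3}/deg card_fset_sum1 big_distrl /= -!big_split /=.
  rewrite big_seq [X in _ <= X]big_seq; apply: leq_sum => s sS.
  by rewrite mul1n /deg (big_fsetD1 s) //=; lia.
by nia.
Qed.

Lemma sum_edges_fsetD1 S A :
  \sum_(s <- S) edges (S `\ s) A + edges S A = #|` S| * edges S A.
Proof.
rewrite [X in _ + X]/edges -big_split card_fset_sum1 big_distrl /=.
by apply: eq_big_seq => s sS; rewrite mul1n [RHS](big_fsetD1 s) //= addnC.
Qed.

(** This is the desired bound multiplied by [#|S| - 1], with the negative term moved to the right so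
    that it can be stated in naturals. *)
Lemma boundary_lower_bound S A B : 2 < #|` S| -> A != fset0 ->
  (forall s, s \in S -> reduced_free (S `\ s)) ->
  [disjoint A & B]%fset ->
  (forall a s, a \in A -> s \in S ->
     ((a * s)%g \in A `|` B) && ((a * s^-1)%g \in A `|` B)) ->
  (forall b, b \in B -> 0 < deg S A b) ->
  2 * (#|` S| * #|` A|) * (#|` S| - 1) + 2 * #|` S| <=
    (#|` S| - 1) * #|` B| + 2 * (#|` S| * #|` A|).
Proof.
move=> S3 A0 freeS dAB bdry degB.
(* The [+ 1] records the strictness of each forest bound; summed over [s] it yields the additive
   constant. *)
have : \sum_(s <- S) (edges (S `\ s) A + \sum_(b <- B) (deg (S `\ s) A b - 1) + 1)
    <= #|` S| * #|` A|.
  rewrite [#|` S|]card_fset_sum1 big_distrl /=.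
  rewrite big_seq [X in _ <= X]big_seq; apply: leq_sum => s sS.
  by rewrite mul1n addn1; apply: edges_forest_boundary; first exact: freeS.
rewrite !big_split /= -card_fset_sum1 exchange_big /=.
have := sum_edges_fsetD1 S A.
have : (#|` S| - 1) * \sum_(b <- B) (deg S A b - 1) <=
    2 * \sum_(b <- B) \sum_(s <- S) (deg (S `\ s) A b - 1).
  by rewrite !big_distrr /=; apply: leq_sum => b _; exact: deg_fsetD1_sum.
have : \sum_(b <- B) (deg S A b - 1) + #|` B| = \sum_(b <- B) deg S A b.
  rewrite card_fset_sum1 -big_split; apply: eq_big_seq => b /degB /=; lia.
have := sum_deg_boundary dAB bdry.
move: (edges S A) (\sum_(b <- B) deg S A b) (\sum_(b <- B) (deg S A b - 1))
  (\sum_(s <- S) edges _ _) (\sum_(b <- B) \sum_(s <- S) _) => e D D1 E X.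
(* Doubling the summed forest bound gives [(m - 1) * (2 * e + D1) + 2 * m <= 2 * m * n], where
   [2 * e + D1 = 2 * m * n - k]. *)
by move: #|` S| #|` A| #|` B| S3 => m n k m3; nia.
Qed.

End Forest.

(** * Passing to the rational inequality *)

Local Open Scope fset_scope.
Local Open Scope ring_scope.

Theorem lemma1p3 (H : groupType) (T : {fset H}) (hT : magnus_marking T)
    (t : nat) (ht : t = (#|` T| - 1)%N) (ht2 : (2 <= t)%N)
    (A : {fset H}) (hA : A != fset0) :
  2 * (t%:R - 1 / t%:R) * #|` A|%:R + 2 * (t%:R + 1) / t%:R
    <= #|` fset_mul A (T `|` fset_inv T) `\` A|%:R :> rat.
Proof.
case: hT => _ freeT; set B := _ `\` A.
have mT : #|` T| = t.+1 by lia.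
have mulB (a g : H) : a \in A -> g \in T `|` fset_inv T -> (a * g)%g \in A `|` B.
  move=> aA gT; rewrite !inE; case: (_ \in A) => //=.
  by apply/imfset2P; exists a => //; exists g.
have invT (s : H) : s \in T -> s^-1%g \in T `|` fset_inv T.
  by move=> sT; rewrite inE; apply/orP; right; apply/imfsetP; exists s.
have : (2 * (#|` T| * #|` A|) * (#|` T| - 1) + 2 * #|` T| <=
    (#|` T| - 1) * #|` B| + 2 * (#|` T| * #|` A|))%N.
  apply: boundary_lower_bound => //; first by lia.
  - by move=> s sT; apply/freely_generates_reduced_free/freeT/fproperD1.
  - by apply/fdisjointP=> a aA; rewrite !inE aA.
  - by move=> a s aA sT; rewrite !mulB ?invT // inE sT.
  (* A boundary point is [a * g] with [a] in [A], so undoing [g] is an edge back to [A]. *)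
  move=> b; rewrite inE => /andP[_ /imfset2P[a /= aA [g gT Eb]]].
  rewrite /deg lt0n sum_nat_seq_neq0; apply/hasP.
  move: gT; rewrite inE => /orP[sT|/imfsetP[s /= sT Eg]].
    by exists g => //=; rewrite Eb mulgK aA addn1.
  by exists s => //=; rewrite Eb Eg mulgVK aA.
rewrite mT -[t.+1]addn1 addnK -(ler_nat rat) !(natrD, natrM).
have t0 : 0 < t%:R :> rat by rewrite ltr0n; lia.
move: (#|` A|%:R : rat) (#|` B|%:R : rat) (t%:R : rat) t0 => n k u u0 le.
rewrite -(ler_pM2l u0).
have -> : u * (2 * (u - 1 / u) * n + 2 * (u + 1) / u) =
   2 * (u ^+ 2 - 1) * n + 2 * (u + 1) by field; exact: lt0r_neq0.
by nra.
Qed.
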